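(* Let $j\ge0$ and assume $\overline{\sigma}_jf=\overline{I}_jf$ for all $f:\mathcal{S}\to[0,\infty]$. Let $\{f_n\}_{n\ge1}\subseteq\mathcal{L}_{\overline{\sigma}_j}$ with $f_n\nearrow f\in Q$. Suppose that for a.e. $S\in\mathcal{S}$, $\int_jf_n\le C=\text{constant}<\infty$ a.e. on $\mathcal{S}_{(S,j)}$ (for all $n$). Then $\|f-f_n\|_j\to0$, $f\in\mathcal{L}_{\overline{\sigma}_j}$ and $\int_jf\doteq\lim_{n\to\infty}\int_jf_n$.
   Context: Setting. Fix $s_0\in\mathbb{R}$ and a trajectory set $\mathcal{S}$, i.e. a (nonempty) set of real sequences $S=(S_i)_{i\ge0}$ with $S_0=s_0$. For $S\in\mathcal{S}$ and $j\ge0$ let $\mathcal{S}_{(S,j)}=\{\tilde S\in\mathcal{S}:\tilde S_i=S_i,\ 0\le i\le j\}$; the pair $(S,j)$ is called a node. Put $\Delta_iS=S_{i+1}-S_i$. For every node a set $\mathcal{H}_{(S,j)}$ of portfolios is given (depending only on the node, i.e. $\mathcal H_{(\tilde S,j)}=\mathcal H_{(S,j)}$ if $\tilde S\in\mathcal S_{(S,j)}$): its elements are sequences $H=(H_i)_{i\ge j}$ of functions $H_i:\mathcal{S}_{(S,j)}\to\mathbb{R}$ that are non-anticipative, i.e. $H_i(\tilde S)=H_i(\hat S)$ whenever $\tilde S_k=\hat S_k$ for $j\le k\le i$. The following is assumed: (H.1) $\alpha\mathcal{H}_{(S,j)}+\mathcal{H}_{(S,j)}\subseteq\mathcal{H}_{(S,j)}$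 for all $\alpha\ge0$; (H.2) every $(H_i)_{i\ge j}$ with each $H_i$ constant on $\mathcal{S}_{(S,j)}$ with value $-1$, $0$ or $1$ belongs to $\mathcal{H}_{(S,j)}$; (H.3) if $(H_i)_{i\ge j}\in\mathcal{H}_{(S,j)}$ and $k\ge j$ then $(H_i|_{\mathcal{S}_{(S,k)}})_{i\ge k}\in\mathcal{H}_{(S,k)}$; (H.4) if $(H_i)_{i\ge j}\in\mathcal{H}_{(S,j)}$, $k\ge j$, $G_i=H_i$ for $j\le i\le k$ and $G_i=0$ for $i>k$, then $G\in\mathcal{H}_{(S,j)}$. Elementary functions. For $V\in\mathbb{R}$, $H\in\mathcal{H}_{(S,j)}$, $n\ge j$ let $\Pi^{V,H}_{j,n}(\tilde S)=V+\sum_{i=j}^{n-1}H_i(\tilde S)\Delta_i\tilde S$ for $\tilde S\in\mathcal{S}_{(S,j)}$; $\mathcal{D}_{(S,j)}$ is the set of all such functions, $\mathcal{D}_{(S,j)}^+$ its non-negative elements, $\mathcal{D}_{(S,j)}^-=-\mathcal{D}_{(S,j)}^+$. Standing assumption 1 (local $0$-neutrality): $\sup_{\tilde S\in\mathcal{S}_{(S,j)}}(\tilde S_{j+1}-S_j)\ge0\ge\inf_{\tilde S\in\mathcal{S}_{(S,j)}}(\tilde S_{j+1}-S_j)$ at every node. Then for $f=\Pi^{V,H}_{j,n}\in\mathcal{D}_{(S,j)}^+$ the value $I_jf(S)=V$ is well defined. Norm and a.e. $Q$ is the set of functions $\mathcal{S}\to[-\infty,\infty]$, $P\subseteq Q$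 the non-negative ones. Conventions: $0\cdot\infty=0$, $\infty+(-\infty)=\infty$, $u-v=u+(-v)$, $\inf\emptyset=\infty$. For $f\in P$, $\overline{I}_jf(S)=\inf\{\sum_{m\ge1}V^m: f\le\sum_{m\ge1}f_m\text{ on }\mathcal{S}_{(S,j)},\ f_m=\Pi^{V^m,H^m}_{j,n_m}\in\mathcal{D}_{(S,j)}^+\}$; for $f\in Q$, $\|f\|_j(S)=\overline{I}_j|f|(S)$ (a function of $S\in\mathcal{S}$) and $\|f\|=\|f\|_0$ (a constant). $E\subseteq\mathcal{S}$ is null if $\|\mathbf{1}_E\|=0$; ''a.e.'' means off a null set, and $\doteq$ denotes equality a.e. Relations between functions that are not qualified by an explicit a.e. (or $\doteq$) are meant at all points where the functions are defined. A property holds a.e. on $\mathcal{S}_{(S,j)}$ if the set $E$ of points of $\mathcal{S}_{(S,j)}$ where it fails satisfies $\|\mathbf{1}_E\|_j(S)=0$. Conditional integral. For $f\in Q$, $\overline{\sigma}_jf(S)=\inf\{\sum_{m\ge0}V^m: f\le\sum_{m\ge0}f_m\text{ on }\mathcal{S}_{(S,j)},\ f_0=\Pi^{V^0,H^0}_{j,n_0}\in\mathcal{D}_{(S,j)}^-,\ f_m=\Pi^{V^m,H^m}_{j,n_m}\in\mathcal{D}_{(S,j)}^+\ (m\ge1)\}$ (for $f_0\in\mathcal D_{(S,j)}^-=-\mathcal D_{(S,j)}^+$, $H^0$ is the negative of a portfolio and $V^0=-I_j(-f_0)(S)$), and $\underline{\sigma}_jf=-\overline{\sigma}_j(-f)$.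 Standing assumption 2: $\overline{\sigma}_j0=0$ on $\mathcal{S}$ for all $j\ge0$. $\mathcal{L}_{\overline{\sigma}_j}=\{f\in Q:\overline{\sigma}_jf-\underline{\sigma}_jf=0\text{ a.e.}\}$, and $\int_jf=\overline{\sigma}_jf$ for $f\in\mathcal{L}_{\overline{\sigma}_j}$.
   Formalization: The convergence ‖f − f_n‖_j → 0 is stated for a.e. S rather than at every S; the everywhere version is false, since integrability and the bound are only assumed a.e. (two trajectories 0 and (0,1,1,…), j=1, f_n = n·1_{b}, b=(0,1,1,…) null). *)

(* Defs.v *)
(* Library: MathComp-Analysis. *)
From HB Require Import structures.
From mathcomp Require Import all_boot all_order all_algebra.
From mathcomp Require Import all_classical all_reals all_analysis.
Set Implicit Arguments.
Unset Strict Implicit.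
Unset Printing Implicit Defensive.
Import Order.TTheory GRing.Theory Num.Theory.
Import numFieldNormedType.Exports.
Local Open Scope classical_set_scope.
Local Open Scope ring_scope.

(* A trajectory set is a set [TS] of real sequences, coerced to the type of its
   elements; the functions in Q are exactly the Rocq functions [TS -> \bar R]. *)

Definition node (R : realType) (TS : set (nat -> R)) (S : TS) (j : nat) :
    set TS :=
  [set x | forall i, (i <= j)%N -> set_val x i = set_val S i].

Definition incr (R : realType) (TS : set (nat -> R)) (i : nat) (x : TS) : R :=
  set_val x i.+1 - set_val x i.

(* A portfolio at the node (S, j) is a family (H_i)_{i >= j} of functions on
   [node S j]. It is represented by total families, whose values for i < j or
   outside [node S j] are junk: [ps_junk] below makes membership in the set of
   portfolios of a node independent of these values. *)
Definition portfolio (R : realType) (TS : set (nat -> R)) : Type :=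
  nat -> TS -> R.

(* With this representation, restricting a family to a later node
   (field [ps_restr]) leaves the representative unchanged. *)
Record portfolio_system (R : realType) (TS : set (nat -> R))
    (PF : TS -> nat -> set (portfolio TS)) : Prop := PortfolioSystem {
  ps_junk : forall S j (H G : portfolio TS), PF S j H ->
    (forall i x, (j <= i)%N -> node S j x -> G i x = H i x) -> PF S j G;
  ps_node : forall S S' j, node S j S' -> PF S' j = PF S j;
  ps_nonanticipative : forall S j (H : portfolio TS), PF S j H ->
    forall i x y, (j <= i)%N -> node S j x -> node S j y ->
      (forall k, (j <= k <= i)%N -> set_val x k = set_val y k) ->
      H i x = H i y;
  ps_cone : forall S j (a : R) (H G : portfolio TS), 0 <= a ->
    PF S j H -> PF S j G -> PF S j (fun i x => a * H i x + G i x);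
  ps_const : forall S j (c : nat -> R),
    (forall i, c i = -1 \/ c i = 0 \/ c i = 1) -> PF S j (fun i _ => c i);
  ps_restr : forall S j k (H : portfolio TS), (j <= k)%N ->
    PF S j H -> PF S k H;
  ps_stop : forall S j k (H : portfolio TS), (j <= k)%N ->
    PF S j H -> PF S j (fun i x => if (i <= k)%N then H i x else 0) }.

Definition local_0_neutral (R : realType) (TS : set (nat -> R)) : Prop :=
  forall (S : TS) (j : nat),
    (0 <= ereal_sup [set (set_val x j.+1 - set_val S j)%:E | x in node S j])%E
    /\
    (ereal_inf [set (set_val x j.+1 - set_val S j)%:E | x in node S j] <= 0)%E.

Definition gain (R : realType) (TS : set (nat -> R))
    (V : R) (H : portfolio TS) (j n : nat) (x : TS) : R :=
  V + \sum_(j <= i < n) H i x * incr i x.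

(* [Dpos PF S j V g]: on [node S j], g is a non-negative elementary function
   with initial value V; only the values of g on [node S j] are relevant. *)
Definition Dpos (R : realType) (TS : set (nat -> R))
    (PF : TS -> nat -> set (portfolio TS)) (S : TS) (j : nat)
    (V : R) (g : TS -> R) : Prop :=
  exists (H : portfolio TS) (n : nat),
    [/\ PF S j H, (j <= n)%N,
        forall x, node S j x -> g x = gain V H j n x
      & forall x, node S j x -> 0 <= g x].

Definition Dneg (R : realType) (TS : set (nat -> R))
    (PF : TS -> nat -> set (portfolio TS)) (S : TS) (j : nat)
    (V : R) (g : TS -> R) : Prop :=
  Dpos PF S j (- V) (fun x => - g x).

(* Addition and subtraction on [-oo, +oo] with +oo + -oo = +oo, i.e. the
   library's dual addition. *)
Definition addQ (R : realType) (u v : \bar R) : \bar R := dual_adde u v.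
Definition subQ (R : realType) (u v : \bar R) : \bar R := addQ u (- v)%E.

(* In [Ibar] and [sigma_bar] the sums over m >= 1 are reindexed from 0, and in
   [sigma_bar] the (finite) term m = 0 is written separately. *)
Definition Ibar (R : realType) (TS : set (nat -> R))
    (PF : TS -> nat -> set (portfolio TS)) (j : nat)
    (f : TS -> \bar R) (S : TS) : \bar R :=
  ereal_inf [set v | exists (V : nat -> R) (g : nat -> TS -> R),
    [/\ forall m, Dpos PF S j (V m) (g m),
        forall x, node S j x -> (f x <= \sum_(0 <= m <oo) (g m x)%:E)%E
      & v = (\sum_(0 <= m <oo) (V m)%:E)%E]].

Definition cnorm (R : realType) (TS : set (nat -> R))
    (PF : TS -> nat -> set (portfolio TS)) (j : nat)
    (f : TS -> \bar R) (S : TS) : \bar R :=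
  Ibar PF j (fun x => `|f x|%E) S.

Definition sigma_bar (R : realType) (TS : set (nat -> R))
    (PF : TS -> nat -> set (portfolio TS)) (j : nat)
    (f : TS -> \bar R) (S : TS) : \bar R :=
  ereal_inf [set v | exists (V0 : R) (g0 : TS -> R)
                            (V : nat -> R) (g : nat -> TS -> R),
    [/\ Dneg PF S j V0 g0,
        forall m, Dpos PF S j (V m) (g m),
        forall x, node S j x ->
          (f x <= (g0 x)%:E + \sum_(0 <= m <oo) (g m x)%:E)%E
      & v = (V0%:E + \sum_(0 <= m <oo) (V m)%:E)%E]].

Definition sigma_low (R : realType) (TS : set (nat -> R))
    (PF : TS -> nat -> set (portfolio TS)) (j : nat)
    (f : TS -> \bar R) (S : TS) : \bar R :=
  (- sigma_bar PF j (fun x => - f x) S)%E.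

(* The norm at time 0 does not depend on S, since all trajectories have the
   same initial value. *)
Definition null_set (R : realType) (TS : set (nat -> R))
    (PF : TS -> nat -> set (portfolio TS)) (E : set TS) : Prop :=
  forall S, cnorm PF 0 (fun x => (\1_E x)%:E) S = 0%E.

Definition almost_every (R : realType) (TS : set (nat -> R))
    (PF : TS -> nat -> set (portfolio TS)) (P : TS -> Prop) : Prop :=
  null_set PF [set S | ~ P S].

Definition almost_every_on (R : realType) (TS : set (nat -> R))
    (PF : TS -> nat -> set (portfolio TS)) (S : TS) (j : nat)
    (P : TS -> Prop) : Prop :=
  cnorm PF j (fun x => (\1_[set y | node S j y /\ ~ P y] x)%:E) S = 0%E.

Definition integrable_at (R : realType) (TS : set (nat -> R))
    (PF : TS -> nat -> set (portfolio TS)) (j : nat) (f : TS -> \bar R) : Prop :=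
  almost_every PF
    (fun S => subQ (sigma_bar PF j f S) (sigma_low PF j f S) = 0%E).

(* Meaningful only when [integrable_at PF j f]. *)
Definition cond_int (R : realType) (TS : set (nat -> R))
    (PF : TS -> nat -> set (portfolio TS)) (j : nat)
    (f : TS -> \bar R) : TS -> \bar R := sigma_bar PF j f.

(* Main.v *)
Require Import Defs.
From HB Require Import structures.
From mathcomp Require Import all_boot all_order all_algebra.
From mathcomp Require Import all_classical all_reals all_analysis.
Set Implicit Arguments.
Unset Strict Implicit.
Unset Printing Implicit Defensive.
Import Order.TTheory GRing.Theory Num.Theory.
Import numFieldNormedType.Exports.
Local Open Scope classical_set_scope.
Local Open Scope ring_scope.

(** Everything happens at a single node. If the conditional integrals of the
    [f_ n] at (S, j) are real numbers [a n] converging to a real [l], then each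
    increment f_(n+1) - f_n is non-negative and, by subadditivity of
    [sigma_bar], satisfies sigma_bar (f_(n+1) - f_n) <= a (n+1) - a n. The
    assumption that [sigma_bar] and [Ibar] agree on non-negative functions turns
    this into a bound on the norm of the increment. As f - f_n is dominated by
    the series of the later increments ([subQ_telescope]) and [Ibar] is
    countably subadditive ([Ibar_nneseries]), ||f - f_n|| <= l - a n, which
    tends to 0. Then f <= f_0 + (f - f_0) gives sigma_bar f <= l, while
    f >= f_n gives sigma_low f >= l. As sigma_low f <= sigma_bar f, both are l:
    this is [monotone_convergence_at].

    Infinite values need no separate null sets. With the convention
    +oo + -oo = +oo the pointwise inequalities between f, f_n and the increments
    hold everywhere, since any undefined difference is +oo.

    To pass from nodes to almost every S, countable unions of null sets are
    null, by countable subadditivity at time 0. The bound on the integrals is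
    only assumed almost everywhere on [node S j]; but the integral is constant
    on that node and the whole node is not a null set of itself
    ([Ibar_gt0]), so the bound holds at S.

    All of this rests on [sigma_bar] 0 = 0, which says that no superhedging of 0
    starts from a negative capital. It makes the initial values of non-negative
    elementary functions non-negative ([Dpos_ge0]), so that the series of
    initial values can be rearranged freely. *)

(** * Series and extended real arithmetic *)

Lemma nneseries_pairing (R : realType) : exists h : nat -> nat * nat,
  forall a : nat -> nat -> \bar R, (forall n m, (0 <= a n m)%E) ->
  (\sum_(0 <= n <oo) \sum_(0 <= m <oo) a n m =
   \sum_(0 <= k <oo) a (h k).1 (h k).2)%E.
Proof.
have /card_esym/ppcard_eqP[h] := card_nat2.
exists h => a a0.
rewrite (nneseries_esumT (fun k => a0 _ _)) nneseries_esumT; last first.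
  by move=> n; exact: nneseries_ge0.
under eq_esum do rewrite nneseries_esumT//.
rewrite esum_esum//= (_ : _ `*`` _ = setT); last by apply/seteqP; split=> -[].
by rewrite (@reindex_esum _ _ _ setT setT h (fun k => a k.1 k.2)).
Qed.

Lemma eseries_single (R : realType) (u : nat -> \bar R) :
  (forall n, u n.+1 = 0%E) -> (\sum_(0 <= n <oo) u n = u 0%N)%E.
Proof.
move=> u0; apply/cvg_lim => //; rewrite -(cvg_shiftS _)/=.
apply: cvg_near_cst; apply: nearW => n.
by rewrite big_nat_recl// big1 ?adde0.
Qed.

Lemma subQ_ge0 (R : realType) (u v : \bar R) :
  (v <= u)%E -> (0 <= subQ u v)%E.
Proof.
rewrite /subQ /addQ /dual_adde.
by case: u v => [x| |] [y| |]//=; rewrite !lee_fin subr_ge0.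
Qed.

Lemma addQ_subQ_ge (R : realType) (u v : \bar R) :
  (u <= addQ v (subQ u v))%E.
Proof.
rewrite /subQ /addQ /dual_adde; case: u v => [x| |] [y| |]//=;
  rewrite ?leey ?leNye//.
by rewrite lee_fin addrC subrK.
Qed.

(** If u 0 is infinite, the first increment is already +oo; otherwise no u n is
    -oo and the partial sums telescope, up to increments equal to +oo. *)
Lemma subQ_telescope (R : realType) (u : nat -> \bar R) (l : \bar R) :
  (forall n, u n <= u n.+1)%E -> u n @[n --> \oo] --> l ->
  (subQ l (u 0%N) <= \sum_(0 <= k <oo) subQ (u k.+1) (u k))%E.
Proof.
move=> u_nd u_l.
have d_ge0 k : (0 <= subQ (u k.+1) (u k))%E by exact: subQ_ge0.
have d_le n : (\sum_(0 <= k < n) subQ (u k.+1) (u k) <=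
    \sum_(0 <= k <oo) subQ (u k.+1) (u k))%E.
  by apply: nneseries_lim_ge => k _ _.
case u0E : (u 0%N) => [r| |].
- set s := (\sum_(0 <= k <oo) _)%E in d_le *.
  suff : (l <= r%:E + s)%E.
    have : (0 <= s)%E by apply: nneseries_ge0 => k _ _.
    rewrite /subQ /addQ /dual_adde.
    by case: l s {d_le u_l} => [x| |] [y| |]//=;
      rewrite ?leey ?leNye// !lee_fin lerBlDl.
  rewrite -(cvg_lim _ u_l)//; apply: lime_le; first by apply/cvg_ex; exists l.
  apply: nearW => n; apply: (le_trans _ (leeD2l _ (d_le n))).
  elim: n => [|n IH]; first by rewrite big_geq// u0E adde0.
  rewrite big_nat_recr//= addeA.
  apply: (@le_trans _ _ (u n + subQ (u n.+1) (u n))%E); last exact: leeD2r.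
  have : (u n != -oo)%E.
    elim: n {IH} => [|n IH]; first by rewrite u0E.
    by rewrite -ltNye (lt_le_trans _ (u_nd n))// ltNye.
  have := u_nd n; rewrite /subQ /addQ /dual_adde.
  by case: (u n) (u n.+1) => [x| |] [y| |]//=; rewrite !lee_fin addrC subrK.
- apply: le_trans (d_le 1%N); rewrite big_nat1 u0E /subQ /addQ /dual_adde.
  by have := u_nd 0%N; rewrite u0E; case: (u 1%N) => //; case: l {u_l}.
- apply: le_trans (d_le 1%N); rewrite big_nat1 u0E /subQ /addQ /dual_adde.
  by case: (u 1%N); rewrite /= leey.
Qed.

(** The two additions differ only when one summand is -oo and the other +oo.
    Then one of U and V is +oo, and the other must not be -oo for U + V to be
    +oo as well. *)
Lemma addQ_le (R : realType) (u v U V : \bar R) :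
  (u <= U)%E -> (v <= V)%E -> (U != -oo)%E -> (V != -oo)%E ->
  (addQ u v <= U + V)%E.
Proof.
rewrite /addQ /dual_adde.
by case: u v U V => [u| |] [v| |] [U| |] [V| |]//=;
  rewrite ?leey ?leNye// !lee_fin => uU vV _ _; exact: lerD.
Qed.

(** * Elementary functions *)

Section Superhedging.
Context (R : realType) (TS : set (nat -> R)).
Context (PF : TS -> nat -> set (portfolio TS)).
Hypothesis PF_system : portfolio_system PF.

Lemma portfolio0 (S : TS) j : PF S j (fun _ _ => 0).
Proof.
by apply: (@ps_const _ _ _ PF_system S j (fun=> 0)) => i; right; left.
Qed.

Lemma Dpos_const (S : TS) j c : 0 <= c -> Dpos PF S j c (fun=> c).
Proof.
move=> c0; exists (fun _ _ => 0), j; split=> // [|x _]; first exact: portfolio0.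
by rewrite /gain big_geq// addr0.
Qed.

(** Stopping H before n changes nothing up to n and stops trading afterwards.
    When n = j there is no last trading time to stop at, and the zero portfolio
    is used instead. *)
Lemma portfolio_extend (S : TS) j V H n N : PF S j H -> (j <= n <= N)%N ->
  exists2 G, PF S j G & gain V G j N =1 gain V H j n.
Proof.
move=> HH /andP[jn nN]; case: (ltngtP j n) jn => // [jn _|<- _]; last first.
  exists (fun _ _ => 0) => [|x]; first exact: portfolio0.
  by rewrite /gain [in RHS]big_geq// big1// => i _; rewrite mul0r.
case: n jn nN => // n jn nN.
exists (fun i x => if (i <= n)%N then H i x else 0) => [|x].
  exact: ps_stop.
rewrite /gain (big_cat_nat (n := n.+1))//=; last exact: leqW.
rewrite [X in _ + (_ + X)]big1_seq ?addr0; last first.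
  move=> i /=; rewrite mem_index_iota ltnNge => /andP[/negbTE->].
  by rewrite mul0r.
by congr (_ + _); apply: eq_big_nat => i /andP[_]; rewrite ltnS => ->.
Qed.

Lemma Dpos_add (S : TS) j V W g h : Dpos PF S j V g -> Dpos PF S j W h ->
  Dpos PF S j (V + W) (fun x => g x + h x).
Proof.
move=> [H [n [HH jn gE g0]]] [K [m [KK jm hE h0]]].
have [||H' HH' H'E] := @portfolio_extend S j V H n (maxn n m);
  rewrite ?jn ?leq_maxl//.
have [||K' KK' K'E] := @portfolio_extend S j W K m (maxn n m);
  rewrite ?jm ?leq_maxr//.
exists (fun i x => 1 * H' i x + K' i x), (maxn n m); split.
- exact: (ps_cone PF_system).
- by rewrite leq_max jn.
- move=> x Sx; rewrite gE// hE// -H'E -K'E /gain addrACA -big_split/=.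
  by congr (_ + _); apply: eq_bigr => i _; rewrite mul1r mulrDl.
- by move=> x Sx; rewrite addr_ge0 ?g0 ?h0.
Qed.

(** * The superhedging functionals *)

Lemma sigma_bar_node (S S' : TS) j f : node S j S' ->
  sigma_bar PF j f S' = sigma_bar PF j f S.
Proof.
move=> SS'; have nE : node S' j = node S j.
  by apply/seteqP; split=> x Hx i ij; rewrite Hx// SS'.
by rewrite /sigma_bar /Dneg /Dpos nE (ps_node PF_system SS').
Qed.

Lemma le_sigma_bar (S : TS) j f g :
  (forall x, node S j x -> (f x <= g x)%E) ->
  (sigma_bar PF j f S <= sigma_bar PF j g S)%E.
Proof.
move=> fg; apply: ereal_inf_le_tmp => v [V0 [g0 [V [h [? ? gh ->]]]]].
exists V0, g0, V, h; split=> // x Sx.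
exact: le_trans (fg _ Sx) (gh _ Sx).
Qed.

Lemma sigma_bar_le_Ibar (S : TS) j f : (sigma_bar PF j f S <= Ibar PF j f S)%E.
Proof.
apply: ereal_inf_le_tmp => v [V [g [Dg fg ->]]].
exists 0, (fun=> 0), V, g; split => // [|x Sx|]; last by rewrite add0e.
  by rewrite /Dneg oppr0; exact: Dpos_const.
by rewrite add0e fg.
Qed.

Lemma le_Ibar (S : TS) j f g :
  (forall x, node S j x -> (f x <= g x)%E) ->
  (Ibar PF j f S <= Ibar PF j g S)%E.
Proof.
move=> fg; apply: ereal_inf_le_tmp => v [V [h [? gh ->]]].
exists V, h; split=> // x Sx.
exact: le_trans (fg _ Sx) (gh _ Sx).
Qed.

Hypothesis sigma_bar0 : forall i (S : TS), sigma_bar PF i (fun=> 0%E) S = 0%E.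

(** Otherwise g alone would superhedge 0 with the negative capital V. *)
Lemma Dpos_ge0 (S : TS) j V g : Dpos PF S j V g -> 0 <= V.
Proof.
move=> Dg; rewrite -lee_fin -[0%:E](sigma_bar0 j S); apply: ereal_inf_lbound.
exists 0, (fun=> 0), (fun m => if m is 0 then V else 0),
  (fun m => if m is 0 then g else fun=> 0); split=> //.
- by rewrite /Dneg oppr0; exact: Dpos_const.
- by case=> // m; exact: Dpos_const.
- move=> x Sx; rewrite add0e; apply: nneseries_ge0 => -[|m] _ _ //.
  by case: Dg => H [n [_ _ _]]; rewrite lee_fin; exact.
- by rewrite add0e (@eseries_single _ (fun m => (if m is 0 then V else 0)%:E)).
Qed.

Lemma Dpos_fun_ge0 (S : TS) j V (g : TS -> R) x :
  Dpos PF S j V g -> node S j x -> 0 <= g x.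
Proof. by move=> [H [n [_ _ _ g0]]]; exact: g0. Qed.

(** Superhedges of f and g add up to a superhedge of [addQ f g], because a
    superhedge never takes the value -oo. *)
Lemma sigma_bar_addQ (S : TS) j f g (a b : R) :
  (sigma_bar PF j f S <= a%:E)%E -> (sigma_bar PF j g S <= b%:E)%E ->
  (sigma_bar PF j (fun x => addQ (f x) (g x)) S <= (a + b)%:E)%E.
Proof.
move=> fa gb; apply/lee_addgt0Pr => e e0.
have e20 : 0 < e / 2 by rewrite divr_gt0.
have /ereal_inf_lt[_ [V0 [h0 [V [h [Dh0 Dh fh ->]]]]] Va] :
    (sigma_bar PF j f S < (a + e / 2)%:E)%E.
  by rewrite (le_lt_trans fa)// lte_fin ltrDl.
have /ereal_inf_lt[_ [W0 [k0 [W [k [Dk0 Dk gk ->]]]]] Wb] :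
    (sigma_bar PF j g S < (b + e / 2)%:E)%E.
  by rewrite (le_lt_trans gb)// lte_fin ltrDl.
apply: (@le_trans _ _ ((V0%:E + \sum_(0 <= m <oo) (V m)%:E) +
                       (W0%:E + \sum_(0 <= m <oo) (W m)%:E))%E); last first.
  by rewrite (le_trans (leeD (ltW Va) (ltW Wb)))// -!EFinD addrACA -splitr.
apply: ereal_inf_lbound.
exists (V0 + W0), (fun x => h0 x + k0 x),
  (fun m => V m + W m), (fun m x => h m x + k m x); split.
- rewrite /Dneg opprD; under eq_fun do rewrite opprD.
  exact: Dpos_add.
- by move=> m; exact: Dpos_add.
- move=> x Sx; under eq_eseriesr do rewrite EFinD.
  have h_ge0 m : 0 <= h m x by exact: Dpos_fun_ge0 (Dh m) Sx.
  have k_ge0 m : 0 <= k m x by exact: Dpos_fun_ge0 (Dk m) Sx.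
  have neqNy r (u : nat -> R) : (forall m, 0 <= u m) ->
      (r%:E + \sum_(0 <= m <oo) (u m)%:E != -oo)%E.
    move=> u0; suff : (0 <= \sum_(0 <= m <oo) (u m)%:E)%E.
      by case: (\sum_(_ <= _ <oo) _)%E.
    by apply: nneseries_ge0 => m _ _; rewrite lee_fin.
  rewrite EFinD nneseriesD; try by move=> m _ _; rewrite lee_fin.
  by rewrite addeACA; apply: addQ_le; [exact: fh|exact: gk| |]; exact: neqNy.
- under [in RHS]eq_eseriesr do rewrite EFinD.
  rewrite [in RHS]nneseriesD; last 2 first.
  + by move=> m _ _; rewrite lee_fin (Dpos_ge0 (Dh m)).
  + by move=> m _ _; rewrite lee_fin (Dpos_ge0 (Dk m)).
  by rewrite EFinD addeACA.
Qed.

Lemma Ibar_ge0 (S : TS) j f : (0 <= Ibar PF j f S)%E.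
Proof.
apply: le_ereal_inf_tmp => _ [V [g [Dg _ ->]]].
by apply: nneseries_ge0 => m _ _; rewrite lee_fin (Dpos_ge0 (Dg m)).
Qed.

(** Superhedges of the F n, each within e / 2 ^ n.+1 of optimal, form a double
    sequence of elementary functions; enumerating it along a bijection between
    nat and nat * nat gives a superhedge of the sum. *)
Lemma Ibar_nneseries (S : TS) j (F : nat -> TS -> \bar R) f :
  (forall n x, node S j x -> (0 <= F n x)%E) ->
  (forall x, node S j x -> (f x <= \sum_(0 <= n <oo) F n x)%E) ->
  (Ibar PF j f S <= \sum_(0 <= n <oo) Ibar PF j (F n) S)%E.
Proof.
move=> F0 fF.
have I0 n : (0 <= Ibar PF j (F n) S)%E by exact: Ibar_ge0.
have [->|] := eqVneq (\sum_(0 <= n <oo) Ibar PF j (F n) S)%E +oo%E.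
  exact: leey.
move=> Ifin; apply/lee_addgt0Pr => e e0.
have : forall n, exists Vg : (nat -> R) * (nat -> TS -> R),
    [/\ forall m, Dpos PF S j (Vg.1 m) (Vg.2 m),
       forall x, node S j x -> (F n x <= \sum_(0 <= m <oo) (Vg.2 m x)%:E)%E
     & (\sum_(0 <= m <oo) (Vg.1 m)%:E <=
         Ibar PF j (F n) S + (e / (2 ^ n.+1)%:R)%:E)%E].
  move=> n; have Infin : Ibar PF j (F n) S \is a fin_num.
    rewrite ge0_fin_numE// ltey; apply: contra_neq Ifin => In.
    by rewrite (nneseries_pinfty _ _ In).
  have /ereal_inf_lt[_ [V [g [Dg Fg ->]]] Vlt] :
      (Ibar PF j (F n) S < Ibar PF j (F n) S + (e / (2 ^ n.+1)%:R)%:E)%E.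
    by rewrite lteDl// lte_fin divr_gt0// ltr0n expn_gt0.
  by exists (V, g); split=> //; exact: ltW.
move=> /choice[Vg VgP].
have [h hE] := nneseries_pairing R.
apply: le_trans (epsilon_trick xpredT I0 (ltW e0)).
have V0 n m : 0 <= (Vg n).1 m by have [Dg _ _] := VgP n; exact: Dpos_ge0 (Dg m).
apply: (@le_trans _ _
  (\sum_(0 <= n <oo) \sum_(0 <= m <oo) ((Vg n).1 m)%:E)%E); last first.
  apply: lee_nneseries => n _; last by have [] := VgP n.
  by move=> _; apply: nneseries_ge0 => m _ _; rewrite lee_fin.
rewrite hE; last by move=> n m; rewrite lee_fin.
apply: ereal_inf_lbound.
exists (fun k => (Vg (h k).1).1 (h k).2), (fun k => (Vg (h k).1).2 (h k).2).
split=> // [k|x Sx]; first by have [] := VgP (h k).1.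
rewrite -(hE (fun n m => ((Vg n).2 m x)%:E)); last first.
  by move=> n m; have [Dg _ _] := VgP n; rewrite lee_fin (Dpos_fun_ge0 (Dg m)).
apply: (le_trans (fF _ Sx)); apply: lee_nneseries => n _.
  by move=> _; exact: F0.
by have [_ + _] := VgP n; exact.
Qed.

(** A superhedge of 1 with capital below 1, minus the constant 1, would
    superhedge 0 with negative capital. *)
Lemma Ibar_gt0 (S : TS) j f :
  (forall x, node S j x -> (1 <= f x)%E) -> (0 < Ibar PF j f S)%E.
Proof.
move=> f1; rewrite ltNge; apply/negP => I0.
have /ereal_inf_lt[_ [V [g [Dg fg ->]]]] : (Ibar PF j f S < 1)%E.
  exact: le_lt_trans I0 _.
apply/negP; rewrite -leNgt.
suff : (0 <= (-1)%:E + \sum_(0 <= m <oo) (V m)%:E)%E.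
  by case: (\sum_(_ <= _ <oo) _)%E => [r| |]//;
    rewrite ?leey// !lee_fin addrC subr_ge0.
rewrite -[leLHS](sigma_bar0 j S).
apply: ereal_inf_lbound; exists (-1), (fun=> -1), V, g; split => //.
  rewrite /Dneg; under eq_fun do rewrite opprK.
  by rewrite opprK; exact: Dpos_const.
move=> x Sx; have := le_trans (f1 _ Sx) (fg _ Sx).
by case: (\sum_(_ <= _ <oo) _)%E => [r| |]//;
  rewrite ?leey// !lee_fin addrC subr_ge0.
Qed.

(** * Monotone convergence at a node *)

Lemma monotone_convergence_at (S : TS) j (f_ : nat -> TS -> \bar R)
    (f : TS -> \bar R) (a : nat -> R) (l : R) :
  (forall g : TS -> \bar R, (forall x, (0 <= g x)%E) ->
     sigma_bar PF j g S = Ibar PF j g S) ->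
  (forall n x, (f_ n x <= f_ n.+1 x)%E) ->
  (forall x, f_ n x @[n --> \oo] --> f x) ->
  (forall n, sigma_bar PF j (f_ n) S = (a n)%:E) ->
  (forall n, sigma_low PF j (f_ n) S = (a n)%:E) ->
  a @ \oo --> l ->
  [/\ forall n, (cnorm PF j (fun x => subQ (f x) (f_ n x)) S <= (l - a n)%:E)%E,
      sigma_bar PF j f S = l%:E & sigma_low PF j f S = l%:E].
Proof.
move=> sI f_nd f_f sf sNf al.
have f_le n x : (f_ n x <= f x)%E.
  have nd : nondecreasing_seq (f_ ^~ x) by exact/nondecreasing_seqP.
  rewrite -(cvg_lim _ (f_f x))// (cvg_lim _ (ereal_nondecreasing_cvgn nd))//.
  by apply: ereal_sup_ubound; exists n.
have sfN n : sigma_bar PF j (fun x => - f_ n x)%E S = (- a n)%:E.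
  by apply: oppe_inj; rewrite -[LHS]/(sigma_low PF j (f_ n) S) sNf EFinN oppeK.
have a_nd : nondecreasing_seq a.
  apply/nondecreasing_seqP => n; rewrite -lee_fin -!sf.
  by apply: le_sigma_bar => x _.
have a_le n : a n <= l.
  rewrite -(cvg_lim _ al)//; apply: nondecreasing_cvgn_le => //.
  by apply/cvg_ex; exists l.
have d_le n :
    (Ibar PF j (fun x => subQ (f_ n.+1 x) (f_ n x)) S <= (a n.+1 - a n)%:E)%E.
  rewrite -sI; last by move=> x; exact: subQ_ge0.
  by apply: sigma_bar_addQ; rewrite ?sf ?sfN.
have norm_le n :
    (cnorm PF j (fun x => subQ (f x) (f_ n x)) S <= (l - a n)%:E)%E.
  apply: (@le_trans _ _ (\sum_(0 <= k <oo)
      Ibar PF j (fun x => subQ (f_ (n + k.+1)%N x) (f_ (n + k)%N x)) S)%E).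
    apply: Ibar_nneseries => [k x _|x _]; first by rewrite addnS subQ_ge0.
    rewrite gee0_abs ?subQ_ge0// -[in leLHS](addn0 n).
    apply: (@subQ_telescope R (fun k => f_ (n + k)%N x)) => [k|].
      by rewrite addnS.
    under eq_fun do rewrite addnC.
    exact: cvg_comp (cvg_addnr n) (f_f x).
  apply: lime_le; first by apply: is_cvg_nneseries => k _ _; exact: Ibar_ge0.
  apply: nearW => m.
  apply: (@le_trans _ _
    (\sum_(0 <= k < m) (a (n + k.+1)%N - a (n + k)%N)%:E)%E).
    by apply: lee_sum => k _; rewrite addnS; exact: d_le.
  rewrite sumEFin lee_fin (telescope_sumr (fun k => a (n + k)%N))//.
  by rewrite addn0 lerB.
(* The single index 0 suffices: the bounds a 0 on sigma_bar (f_ 0) and l - a 0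
   on the norm of f - f_0 add up to exactly l. *)
have sf_le : (sigma_bar PF j f S <= l%:E)%E.
  rewrite -[l](subrKC (a 0%N)).
  apply: (@le_trans _ _
    (sigma_bar PF j (fun x => addQ (f_ 0%N x) (subQ (f x) (f_ 0%N x))) S)).
    by apply: le_sigma_bar => x _; exact: addQ_subQ_ge.
  apply: sigma_bar_addQ; first by rewrite sf.
  rewrite (le_trans (sigma_bar_le_Ibar _ _ _))// (le_trans _ (norm_le 0%N))//.
  by apply: le_Ibar => x _; exact: lee_abs.
have sf_ge n : ((a n)%:E <= sigma_bar PF j f S)%E.
  by rewrite -sf; apply: le_sigma_bar => x _.
have sNf_ge n : ((a n)%:E <= sigma_low PF j f S)%E.
  rewrite /sigma_low leeNr -EFinN -sfN.
  by apply: le_sigma_bar => x _; rewrite leeN2.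
have l_le z : (forall n, ((a n)%:E <= z)%E) -> (l%:E <= z)%E.
  move=> az; have al' : (a n)%:E @[n --> \oo] --> l%:E.
    by apply: cvg_EFin => //; exact: nearW.
  rewrite -(cvg_lim _ al')//; apply: lime_le; last exact: nearW.
  by apply/cvg_ex; exists l%:E.
split=> //; apply/eqP; rewrite eq_le; first by rewrite sf_le l_le.
(* sigma_low f > l would give sigma_bar (f - f) < 0, although f - f >= 0 for
   the convention on infinite values. *)
rewrite [(l%:E <= _)%E]l_le// andbT leeNl -EFinN leNgt; apply/negP => lt_l.
have [b fb bl] : exists2 b : R,
    (sigma_bar PF j (fun x => - f x)%E S <= b%:E)%E & b < - l.
  move: lt_l; case: (sigma_bar _ _ _ _) => [r rl| |_]//.
  - by exists r.
  - by exists (- l - 1); rewrite ?leNye// ltrBlDr ltrDl.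
have : (0 <= (l + b)%:E)%E.
  rewrite -(sigma_bar0 j S); apply: le_trans (sigma_bar_addQ sf_le fb).
  by apply: le_sigma_bar => x _; exact: subQ_ge0.
by rewrite lee_fin leNgt -ltrBrDl sub0r bl.
Qed.

(** * Null sets *)

Lemma null_set_sub (A B : set TS) :
  A `<=` B -> Defs.null_set PF B -> Defs.null_set PF A.
Proof.
move=> AB B0 S; apply/eqP; rewrite eq_le Ibar_ge0 andbT -(B0 S).
apply: le_Ibar => x _; rewrite !gee0_abs ?lee_fin//.
rewrite !indicE ler_nat; case: (boolP (x \in A)) => //.
by rewrite !inE => /AB/mem_set->.
Qed.

Lemma null_set_bigcup (A : nat -> set TS) :
  (forall n, Defs.null_set PF (A n)) -> Defs.null_set PF (\bigcup_n A n).
Proof.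
move=> A0 S; apply/eqP; rewrite eq_le Ibar_ge0 andbT.
rewrite -[leRHS](@eseries0 _
  (fun n => cnorm PF 0 (fun x => (\1_(A n) x)%:E) S) 0%N xpredT); last first.
  by move=> n _ _; exact: A0.
apply: Ibar_nneseries => // x _.
rewrite gee0_abs ?lee_fin// indicE.
have [/set_mem[n _ Anx]|_] := boolP (x \in \bigcup_n A n); last first.
  exact: nneseries_ge0.
rewrite (@nneseriesD1 _ _ n)// [X in (_ <= X + _)%E]gee0_abs ?lee_fin//.
by rewrite indicE mem_set// leeDl// nneseries_ge0.
Qed.

Lemma almost_every_impl (P Q : TS -> Prop) : (forall S, P S -> Q S) ->
  almost_every PF P -> almost_every PF Q.
Proof. by move=> PQ; apply: null_set_sub => S; exact/contra_not/PQ. Qed.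

Lemma almost_every_forall (P : nat -> TS -> Prop) :
  (forall n, almost_every PF (P n)) ->
  almost_every PF (fun S => forall n, P n S).
Proof.
move=> P0; apply: null_set_sub (null_set_bigcup P0) => S /=.
by rewrite -existsNE => -[n nP]; exists n.
Qed.

(** The integral is constant on the node, so the exceptional set is either empty
    or the whole node, and the latter is not null. *)
Lemma sigma_bar_le_of_almost_every_on (S : TS) j f (C : \bar R) :
  almost_every_on PF S j (fun x => (cond_int PF j f x <= C)%E) ->
  (sigma_bar PF j f S <= C)%E.
Proof.
move=> E0; rewrite leNgt; apply/negP => Cf.
suff : (0 < cnorm PF j (fun x =>
    (\1_[set y | node S j y /\ ~ (cond_int PF j f y <= C)%E] x)%:E) S)%E.
  by rewrite [X in (_ < X)%E]E0 ltxx.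
apply: Ibar_gt0 => x Sx; rewrite indicE mem_set ?abse1//=.
by split=> //; apply/negP; rewrite -ltNge /cond_int (sigma_bar_node _ Sx).
Qed.

End Superhedging.

(** * The theorem *)

Theorem proposition12 (R : realType) (s0 : R) (TS : set (nat -> R))
  (TS_nonempty : TS !=set0)
  (TS_start : forall x, TS x -> x 0%N = s0)
  (PF : TS -> nat -> set (portfolio TS))
  (PF_system : portfolio_system PF)
  (neutral : local_0_neutral TS)
  (sigma_bar0 : forall (i : nat) (S : TS), sigma_bar PF i (fun=> 0%E) S = 0%E)
  (j : nat)
  (sigma_bar_Ibar : forall g : TS -> \bar R, (forall S, (0 <= g S)%E) ->
     forall S, sigma_bar PF j g S = Ibar PF j g S)
  (f_ : nat -> TS -> \bar R) (f : TS -> \bar R)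
  (f_integrable : forall n, integrable_at PF j (f_ n))
  (f_nondecreasing : forall n S, (f_ n S <= f_ n.+1 S)%E)
  (f_cvg : forall S, f_ n S @[n --> \oo] --> f S)
  (f_bounded : almost_every PF (fun S => exists C : \bar R, (C < +oo)%E /\
     forall n, almost_every_on PF S j
       (fun x => (cond_int PF j (f_ n) x <= C)%E))) :
  [/\ almost_every PF (fun S =>
        cnorm PF j (fun x => subQ (f x) (f_ n x)) S @[n --> \oo] --> 0%E),
      integrable_at PF j f
    & almost_every PF (fun S =>
        cond_int PF j (f_ n) S @[n --> \oo] --> cond_int PF j f S)].
Proof.
(* The regular S form a set of full measure; the rest of the argument takes
   place at one such S. *)
pose sg n := sigma_bar PF j (f_ n).
pose bounded S := exists C : \bar R, (C < +oo)%E /\ forall n,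
  almost_every_on PF S j (fun x => (cond_int PF j (f_ n) x <= C)%E).
pose regular S := bounded S /\
  forall n, subQ (sg n S) (sigma_low PF j (f_ n) S) = 0%E.
have ae_regular : almost_every PF regular.
  pose P n S := if n is m.+1 then subQ (sg m S) (sigma_low PF j (f_ m) S) = 0%E
    else bounded S.
  apply: (@almost_every_impl _ _ _ PF_system sigma_bar0
    (fun S => forall n, P n S) regular).
    by move=> S PS; split; [exact: (PS 0%N)|move=> n; exact: (PS n.+1)].
  apply: (almost_every_forall PF_system sigma_bar0) => -[|n].
    exact: f_bounded.
  exact: f_integrable.
have at_regular S : regular S -> exists (a : nat -> R) (l : R), [/\
    a @ \oo --> l, forall n, sg n S = (a n)%:E,
    forall n, (cnorm PF j (fun x => subQ (f x) (f_ n x)) S <= (l - a n)%:E)%E,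
    sigma_bar PF j f S = l%:E & sigma_low PF j f S = l%:E].
  move=> [[C [C_lty sg_C]] sg0].
  (* Both integrals are finite: +oo - +oo and -oo + +oo are +oo, not 0. *)
  have fin n : exists r : R, sg n S = r%:E /\ sigma_low PF j (f_ n) S = r%:E.
    have := sg0 n; rewrite /subQ /addQ /dual_adde.
    case: (sg n S) (sigma_low PF j (f_ n) S) => [x| |] [y| |]//= [/eqP].
    by rewrite subr_eq0 => /eqP ->; exists y.
  have [a aE] := choice fin.
  have sg_le n : (sg n S <= C)%E.
    exact: (sigma_bar_le_of_almost_every_on PF_system).
  have a_nd : nondecreasing_seq a.
    apply/nondecreasing_seqP => n; rewrite -lee_fin -(aE n).1 -(aE n.+1).1.
    by apply: le_sigma_bar => x _.
  have a_cvg : cvgn a.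
    apply: nondecreasing_is_cvgn => //; exists (fine C) => _ [n _ <-].
    have := sg_le n; rewrite (aE n).1.
    by case: C C_lty {sg_C sg_le} => // r _; rewrite lee_fin.
  have [norm_le sfE sNfE] := monotone_convergence_at PF_system sigma_bar0
    (fun g g0 => sigma_bar_Ibar g g0 S) f_nondecreasing f_cvg
    (fun n => (aE n).1) (fun n => (aE n).2) a_cvg.
  by exists a, (limn a); split=> // n; rewrite (aE n).1.
split; apply: (almost_every_impl PF_system sigma_bar0 _ ae_regular) => S
  /at_regular[a [l [al sgE norm_le sfE sNfE]]].
- apply: (@squeeze_cvge _ _ _ _ (fun=> 0%E) _ (fun n => (l - a n)%:E)).
  + by apply: nearW => n; rewrite norm_le andbT; exact: Ibar_ge0.
  + exact: cvg_cst.
  + apply: cvg_EFin; first exact: nearW.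
    by rewrite -(subrr l); apply: cvgB => //; exact: cvg_cst.
- by rewrite sfE sNfE /subQ /addQ /dual_adde /= subrr.
- rewrite /cond_int sfE; under eq_fun do rewrite [sigma_bar _ _ _ _]sgE.
  by apply: cvg_EFin => //; exact: nearW.
Qed.
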